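(* Fix an integer $q\ge 2$. There are positive constants $c_1,c_2,c_3$ (depending only on $q$) such that for every $d\ge 1$, every $N$ and every $d$-regular bipartite graph $G$ on $N$ vertices, the following holds. Let $\chi$ be a uniformly chosen proper $q$-colouring of $G$ (with colour set $\{1,\dots,q\}$) and let $\varepsilon \geq c_1/\sqrt{d}$. If $q$ is even then $${\rm Pr}\left(\exists k \in \{1,\dots,q\}: \left|\frac{|\chi^{-1}(k)|}{N} - \frac{1}{q}\right| \geq \varepsilon \right) \leq c_2\varepsilon^{-1}2^{-c_3\varepsilon^2N},$$ and if $q$ is odd then $${\rm Pr}\left(\exists k \in \{1,\dots,q\}: \frac{|\chi^{-1}(k)|}{N} \leq \frac{1}{q+1} - \varepsilon\right) < c_2\varepsilon^{-1}2^{-c_3\varepsilon^2N}$$ and $${\rm Pr}\left(\exists k \in \{1,\dots,q\}: \frac{|\chi^{-1}(k)|}{N} \geq \frac{1}{q-1} + \varepsilon\right) < c_2\varepsilon^{-1}2^{-c_3\varepsilon^2N}.$$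
   Context: Graphs $G$ are simple, loopless and finite. A proper $q$-colouring of $G$ is a function $\chi:V(G)\to\{1,\dots,q\}$ with $\chi(u)\ne\chi(v)$ whenever $uv\in E(G)$. *)

(* Defs.v *)
From HB Require Import structures.
From mathcomp Require Import all_boot all_order all_algebra.
From mathcomp Require Import all_reals.
Set Implicit Arguments.
Unset Strict Implicit.
Unset Printing Implicit Defensive.
Import Order.TTheory GRing.Theory Num.Theory.
Local Open Scope ring_scope.

(* Graphs are given by their adjacency relation on a finite vertex type. *)
Definition simple_graph (V : finType) (e : rel V) : Prop :=
  symmetric e /\ irreflexive e.

Definition regular_graph (V : finType) (e : rel V) (d : nat) : Prop :=
  forall u : V, #|[set v | e u v]| = d.

Definition bipartite_graph (V : finType) (e : rel V) : Prop :=
  exists A : {set V}, forall u v : V, e u v -> (u \in A) != (v \in A).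

(* The colour set {1, ..., q} is represented by 'I_q = {0, ..., q - 1}. *)
Definition proper_colourings (V : finType) (e : rel V) (q : nat) :
    {set {ffun V -> 'I_q}} :=
  [set chi : {ffun V -> 'I_q} |
    [forall u : V, forall v : V, e u v ==> (chi u != chi v)]].

(* The quotient takes the junk value 0 if there is no proper q-colouring,
   which cannot happen for a bipartite graph and q >= 2. *)
Definition Pr_colouring (R : realType) (V : finType) (e : rel V) (q : nat)
    (E : pred {ffun V -> 'I_q}) : R :=
  #|[set chi in proper_colourings e q | E chi]|%:R
    / #|proper_colourings e q|%:R.

Definition colour_freq (R : realType) (V : finType) (q : nat)
    (chi : {ffun V -> 'I_q}) (k : 'I_q) : R :=
  #|chi @^-1: [set k]|%:R / #|V|%:R.

(* Main.v *)
Require Import Defs.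
From HB Require Import structures.
From mathcomp Require Import all_boot all_order all_algebra.
From mathcomp Require Import all_reals sequences exp.
From mathcomp Require Import lra ring zify.
Set Implicit Arguments.
Unset Strict Implicit.
Unset Printing Implicit Defensive.
Import Order.TTheory GRing.Theory Num.Theory.
Local Open Scope ring_scope.

(** Write [W_T] for the total weight of a colour set [T] when colour [k] has
    weight [l] and every other colour weight 1, and let [M = N/2] be the common
    size of the two sides of the graph.  The exponential moment of the number
    of vertices coloured [k] is the weighted count
    [Z(l) = \sum_chi l ^ #chi^-1(k)] divided by [Z(1)], so a tail bound
    follows from an upper bound on [Z(l)] and a lower bound on [Z(1)].

    The lower bound is immediate: colouring one side from a set of [m] colours
    and the other side from its complement gives [Z(1) >= (m (q - m)) ^ M].

    For the upper bound, sum out the colours of one side [B] first.  Given the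
    colours of the other side [A], each [b] in [B] contributes the weight of
    the colours missing from its neighbourhood, so [Z(l)] is a sum of a product
    of functions of the stars of the [b]'s.  Every vertex of [A] is in exactly
    [d] stars, so the inequality of Finner (iterated Hoelder, lemma [finner])
    bounds this sum by the product of the [L^d] norms.  The [d]-th power of
    each norm is a sum over lists of [d] colours; sorting the lists by the set
    of colours that they use bounds it by the sum of [(W_T * W_(~: T)) ^ d] over
    the [2 ^ q] colour sets [T].  Hence
    [Z(l) <= (2 ^ (q/d) * max_T W_T * W_(~: T)) ^ M], essentially the lemma
    [partition_le].

    Near [l = 1] the maximum over [T] is attained by balanced splittings: with
    [L = m (q - m)] and [m = q./2] it is at most [L * exp (2 P (l - 1))], where
    [P] is [1/q] for even [q], and for odd [q] is [1/(q+1)] when [l <= 1] and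
    [1/(q-1)] when [l >= 1].  This asymmetry is what separates the two
    thresholds for odd [q]: for [l < 1] the colour [k] is best put on the side
    that has [m + 1] colours, for [l > 1] on the side that has [m].  So
    [Z(l) / Z(1) <= exp (N (P (l - 1) + q / (2 d)))], which is a Poisson
    moment generating function up to the factor [exp (q N / (2 d))].
    Markov's inequality with [l = exp (+- eps/4)] gives the tail
    [exp (- eps^2 N / 16)], the extra factor being absorbed because
    [eps >= c1 / sqrt d] (lemma [tail_le]).  A union bound over the
    colours concludes, since [eps > 1] makes the events empty and
    [eps <= 1] makes [eps^-1 >= 1]. *)

(** * Hoelder inequality for a product of [d] functions *)

Section Holder.

Variables (R : realType) (d : nat).
Hypothesis d_gt0 : (0 < d)%N.

Definition droot (x : R) : R := x `^ d%:R^-1.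

Lemma droot_ge0 x : 0 <= droot x.
Proof. exact: powR_ge0. Qed.

Lemma drootK x : 0 <= x -> droot x ^+ d = x.
Proof.
move=> x0; rewrite -powR_mulrn ?droot_ge0 // /droot -powRrM mulVf ?powRr1 //.
by rewrite pnatr_eq0 -lt0n.
Qed.

Lemma droot_le x y : 0 <= x -> 0 <= y -> x <= y ^+ d -> droot x <= y.
Proof.
move=> x0 y0 xy.
by rewrite -(ler_pXn2r d_gt0) ?nnegrE ?droot_ge0 // drootK.
Qed.

Lemma drootX x : 0 <= x -> droot (x ^+ d) = x.
Proof.
move=> x0; apply/eqP; rewrite -(eqrXn2 d_gt0) ?droot_ge0 //.
by rewrite drootK // exprn_ge0.
Qed.

Variables (J C : finType).

Lemma prod_droot_le (D : {set J}) (u : J -> R) :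
  #|D| = d -> (forall j, 0 <= u j) ->
  \prod_(j in D) droot (u j) <= (\sum_(j in D) u j) / d%:R.
Proof.
move=> cD u0.
rewrite -(ler_pXn2r d_gt0) ?nnegrE; first last.
- by rewrite divr_ge0 // sumr_ge0.
- by rewrite prodr_ge0 // => j _; exact: droot_ge0.
rewrite -prodrXl (eq_bigr u); last by move=> j _; rewrite drootK.
by have := (leif_AGM (in1W u0 : {in D, forall j, 0 <= u j})).1; rewrite cD.
Qed.

(** After dividing each [h j] by its weighted sum, the claim is the arithmetic-
    geometric mean inequality applied pointwise and then summed.  If one of the
    sums vanishes, then every term on the left vanishes too. *)
Lemma holder_finset (D : {set J}) (w : C -> R) (h : J -> C -> R) :
  #|D| = d -> (forall y, 0 <= w y) -> (forall j y, 0 <= h j y) ->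
  \sum_y w y * \prod_(j in D) droot (h j y) <=
  \prod_(j in D) droot (\sum_y w y * h j y).
Proof.
move=> cD w0 h0; pose H j := \sum_y w y * h j y.
have H0 j : 0 <= H j by apply: sumr_ge0 => y _; rewrite mulr_ge0.
case: (boolP [exists j in D, H j == 0]) => [/exists_inP[j jD /eqP Hj]|].
  rewrite big1 ?prodr_ge0 // => [j' _|y _]; first exact: droot_ge0.
  have /eqP : w y * h j y = 0.
    apply: (psumr_eq0P _ Hj) => // z _; exact: mulr_ge0.
  rewrite mulf_eq0 => /orP[/eqP->|/eqP hy]; first by rewrite mul0r.
  rewrite (bigD1 j) //= hy [droot 0]powR0 ?mul0r ?mulr0 //.
  by rewrite invr_eq0 pnatr_eq0 -lt0n.
rewrite negb_exists_in => /forall_inP Hn0.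
have Hp j : j \in D -> 0 < H j by move=> jD; rewrite lt_neqAle eq_sym Hn0 /=.
set P := \prod_(j in D) _.
have -> : \sum_y w y * \prod_(j in D) droot (h j y) =
    P * \sum_y w y * \prod_(j in D) droot (h j y / H j).
  rewrite mulr_sumr; apply: eq_bigr => y _; rewrite mulrCA; congr (_ * _).
  rewrite -big_split /=; apply: eq_bigr => j jD.
  rewrite -/(H j) /droot -powRM ?divr_ge0 ?H0 //.
  by rewrite mulrC divfK ?Hn0.
rewrite ler_piMr ?prodr_ge0 // => [j _|]; first exact: droot_ge0.
apply: (@le_trans _ _ (\sum_y w y * ((\sum_(j in D) h j y / H j) / d%:R))).
  apply: ler_sum => y _; apply: ler_wpM2l => //.
  by apply: prod_droot_le => // j; rewrite divr_ge0.
under eq_bigr do rewrite mulrA mulr_sumr.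
rewrite -mulr_suml exchange_big /= (eq_bigr (fun=> 1)).
  by rewrite sumr_const cD divff // pnatr_eq0 -lt0n.
move=> j jD; under eq_bigr do rewrite mulrA.
by rewrite -mulr_suml divff // Hn0.
Qed.

End Holder.

(** * Iterated weighted sums and the inequality of Finner *)

Section IteratedSum.

Variables (R : realType) (V C : finType) (w : C -> R).
Hypothesis w_ge0 : forall y, 0 <= w y.

Implicit Types (f : {ffun V -> C}) (F G : {ffun V -> C} -> R) (s : seq V).

Definition upd f (x : V) (y : C) : {ffun V -> C} :=
  [ffun v => if v == x then y else f v].

(** The integral over the colours of the vertices listed in [s], the other
    vertices being coloured by [f], with respect to the product of the measures
    [w].  Summing one vertex at a time makes induction on the variables
    available, and a partial sum is again a function of a full colouring. *)
Fixpoint isum s F f : R :=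
  if s is x :: s' then \sum_y w y * isum s' F (upd f x y) else F f.

Definition indep F (x : V) := forall f y, F (upd f x y) = F f.

Lemma upd_neq f x y v : v != x -> upd f x y v = f v.
Proof. by rewrite ffunE => /negbTE->. Qed.

Lemma upd_eq f x y : upd f x y x = y.
Proof. by rewrite ffunE eqxx. Qed.

Lemma isum_ge0 s F f : (forall g, 0 <= F g) -> 0 <= isum s F f.
Proof.
move=> F0; elim: s f => //= x s IH f.
by apply: sumr_ge0 => y _; rewrite mulr_ge0.
Qed.

Lemma isum_le s F G f : (forall g, F g <= G g) -> isum s F f <= isum s G f.
Proof.
move=> FG; elim: s f => //= x s IH f.
by apply: ler_sum => y _; rewrite ler_wpM2l.
Qed.

Lemma eq_isum s F G f : F =1 G -> isum s F f = isum s G f.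
Proof. by move=> FG; elim: s f => //= x s IH f; under eq_bigr do rewrite IH. Qed.

Lemma isum_cat s1 s2 F f : isum (s1 ++ s2) F f = isum s1 (isum s2 F) f.
Proof. by elim: s1 f => //= x s IH f; under eq_bigr do rewrite IH. Qed.

Lemma isum_sum (I : finType) (F : I -> {ffun V -> C} -> R) s f :
  isum s (fun g => \sum_i F i g) f = \sum_i isum s (F i) f.
Proof.
elim: s f => //= x s IH f; rewrite exchange_big /=.
by apply: eq_bigr => y _; rewrite IH mulr_sumr.
Qed.

Lemma isum_scale s c F f :
  {in s, forall x, indep c x} ->
  isum s (fun g => c g * F g) f = c f * isum s F f.
Proof.
elim: s f => //= x s IH f ci; rewrite mulr_sumr; apply: eq_bigr => y _.
rewrite IH => [|z zs]; last by apply: ci; rewrite inE zs orbT.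
by rewrite ci ?mem_head // mulrCA.
Qed.

Lemma isum_indep s F x : indep F x -> indep (isum s F) x.
Proof.
move=> Fx; elim: s => //= z s IH f y; apply: eq_bigr => y' _; congr (_ * _).
have [->|zx] := eqVneq z x.
  congr (isum _ _ _); apply/ffunP => v; rewrite !ffunE.
  by case: eqP.
rewrite -(IH (upd f z y') y); congr (isum _ _ _); apply/ffunP => v.
by rewrite !ffunE; case: (eqVneq v z) => // ->; rewrite (negbTE zx).
Qed.

(** Fubini for a product of functions each of which depends on a single summed
    vertex.  The factor at [x] may still depend on the colours of the vertices
    outside [s]: this is what allows one side of a bipartite graph to be summed
    out while the other side is kept. *)
Lemma isum_prod s (phi : V -> {ffun V -> C} -> C -> R) f :
  uniq s -> {in s &, forall x z y, indep (fun g => phi x g y) z} ->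
  isum s (fun g => \prod_(x <- s) phi x g (g x)) f =
  \prod_(x <- s) \sum_y w y * phi x f y.
Proof.
elim: s f => [|x s IH] f /=; first by rewrite !big_nil.
move=> /andP[xs us] phii; rewrite big_cons mulr_suml; apply: eq_bigr => y _.
rewrite -mulrA; congr (_ * _).
under eq_isum do rewrite big_cons.
rewrite (@isum_scale _ (fun g => phi x g (g x))) => [|z zs g y' /=].
  have xin : x \in x :: s by rewrite mem_head.
  rewrite upd_eq phii // IH //; last first.
    by move=> a b a_s b_s; apply: phii; rewrite inE ?a_s ?b_s orbT.
  congr (_ * _); rewrite !big_seq; apply: eq_bigr => z zs.
  by apply: eq_bigr => y' _; rewrite phii // inE zs orbT.
have xz : x != z by apply: contraNneq xs => ->.
by rewrite upd_neq // phii // ?mem_head // inE zs orbT.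
Qed.

Lemma isum_full s F f :
  uniq s -> isum s F f =
  \sum_(g : {ffun V -> C} | [forall x, (x \notin s) ==> (g x == f x)])
     (\prod_(x <- s) w (g x)) * F g.
Proof.
elim: s f => [|x s IH] f /=.
  move=> _; rewrite (big_pred1 f) ?big_nil ?mul1r // => g.
  apply/forallP/eqP => [H|-> //]; apply/ffunP => x.
  by have /eqP := H x.
move=> /andP[xs us]; rewrite (partition_big (fun g : {ffun _ -> _} => g x) predT) //=.
apply: eq_bigr => y _; rewrite IH // mulr_sumr; apply: eq_big => g.
  apply/forallP/andP => [H|[/forallP H /eqP gx] z].
    split; last by have := H x; rewrite xs upd_eq.
    apply/forallP => z; apply/implyP; rewrite inE negb_or => /andP[zx zs].
    by have := H z; rewrite zs upd_neq.
  apply/implyP => zs; have [->|zx] := eqVneq z x; first by rewrite upd_eq gx.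
  by have := H z; rewrite inE negb_or zx zs upd_neq.
by case/forallP/(_ x); rewrite xs upd_eq big_cons => /eqP->; rewrite mulrA.
Qed.

(** Induction on the summed vertices.  When the colour of [x] is summed, the
    [d] factors whose star contains [x] are handled by Hoelder and all others
    are constant. *)
Lemma finner (d : nat) (J : finType) (B : {set J}) (N : J -> {set V})
    (h : J -> {ffun V -> C} -> R) s f :
  (0 < d)%N ->
  {in s, forall x, #|[set j in B | x \in N j]| = d} ->
  (forall j g, 0 <= h j g) ->
  (forall j x, x \notin N j -> indep (h j) x) ->
  isum s (fun g => \prod_(j in B) droot d (h j g)) f <=
  \prod_(j in B) droot d (isum [seq x <- s | x \in N j] (h j) f).
Proof.
move=> d0 deg h0 hi; elim: s f deg => //= x s IH f deg.
set D := [set j in B | x \in N j].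
have split_prod (u : J -> R) : \prod_(j in B) u j =
    \prod_(j in D) u j * \prod_(j in B | x \notin N j) u j.
  rewrite (bigID (fun j => x \in N j)) /=; congr (_ * _).
  by apply: eq_bigl => j; rewrite inE.
pose h' j := isum [seq z <- s | z \in N j] (h j).
have h'0 j g : 0 <= h' j g by apply: isum_ge0.
apply: (@le_trans _ _
    (\sum_y w y * \prod_(j in B) droot d (h' j (upd f x y)))).
  apply: ler_sum => y _; rewrite ler_wpM2l // IH // => z zs.
  by apply: deg; rewrite inE zs orbT.
rewrite [leRHS]split_prod.
have -> : \prod_(j in B | x \notin N j) droot d
      (isum (if x \in N j then x :: [seq z <- s | z \in N j]
             else [seq z <- s | z \in N j]) (h j) f) =
    \prod_(j in B | x \notin N j) droot d (h' j f).
  by apply: eq_bigr => j /andP[_ /negbTE->].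
have -> : \prod_(j in D) droot d
      (isum (if x \in N j then x :: [seq z <- s | z \in N j]
             else [seq z <- s | z \in N j]) (h j) f) =
    \prod_(j in D) droot d (\sum_y w y * h' j (upd f x y)).
  by apply: eq_bigr => j; rewrite inE => /andP[_ ->].
have step y : \prod_(j in B) droot d (h' j (upd f x y)) =
    \prod_(j in D) droot d (h' j (upd f x y)) *
    \prod_(j in B | x \notin N j) droot d (h' j f).
  rewrite [LHS]split_prod; congr (_ * _); apply: eq_bigr => j /andP[_ xj].
  by rewrite /h' (isum_indep _ (hi _ _ xj)).
rewrite (eq_bigr _ (fun y _ => congr1 ( *%R (w y)) (step y))).
under eq_bigr do rewrite mulrA.
rewrite -mulr_suml; apply: ler_wpM2r.
  by apply: prodr_ge0 => j _; exact: droot_ge0.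
by apply: (@holder_finset _ _ d0 _ _ D w (fun j y => h' j (upd f x y))) => //;
  apply: deg; rewrite mem_head.
Qed.

End IteratedSum.

(** * Upper bound on the weighted number of colourings *)

Section Partition.

Variables (R : realType) (q d : nat) (V : finType) (e : rel V) (A : {set V}).
Hypotheses (d_gt0 : (0 < d)%N) (e_sym : symmetric e).
Hypothesis e_bip : forall u v, e u v -> (u \in A) != (v \in A).
Hypothesis e_reg : regular_graph e d.

Lemma side_notin u v : e u v -> u \in A -> v \notin A.
Proof. by move=> /e_bip; case: (u \in A) (v \in A) => [] []. Qed.

Lemma side_in u v : e u v -> u \notin A -> v \in A.
Proof. by move=> /e_bip; case: (u \in A) (v \in A) => [] []. Qed.

(** Both sides meet all edges, and each vertex meets [d] of them. *)
Lemma card_sides : #|A| = #|~: A|.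
Proof.
apply/eqP; rewrite -(eqn_pmul2r d_gt0) -!sum_nat_const; apply/eqP.
transitivity (\sum_(u in A) \sum_(v in ~: A) (e u v : nat))%N.
  apply: eq_bigr => u uA; rewrite -(e_reg u) -sum1_card.
  rewrite big_mkcond [RHS]big_mkcond; apply: eq_bigr => v _; rewrite !inE.
  by case euv: (e u v); rewrite ?if_same // (side_notin euv).
rewrite exchange_big /=; apply: eq_bigr => v; rewrite inE => vA.
rewrite -(e_reg v) -sum1_card big_mkcond [RHS]big_mkcond.
apply: eq_bigr => u _; rewrite !inE e_sym.
by case euv: (e v u); rewrite ?if_same // (side_in euv).
Qed.

Variables (w : 'I_q -> R) (K : R).
Hypothesis w_ge0 : forall y, 0 <= w y.

Let W (T : {set 'I_q}) := \sum_(y in T) w y.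

Hypothesis K_ge0 : 0 <= K.
Hypothesis W_le : forall T : {set 'I_q}, W T * W (~: T) <= K.

Let allowed (b : V) (f : {ffun V -> 'I_q}) (y : 'I_q) : bool :=
  [forall x, e b x ==> (f x != y)].

(** The contribution of [b] once the colours of its neighbours are fixed, raised
    to the power [d] to put it in the form that [finner] takes. *)
Let star_weight (b : V) (f : {ffun V -> 'I_q}) : R :=
  (\sum_y w y * (allowed b f y)%:R) ^+ d.

Lemma star_weight_ge0 b f : 0 <= star_weight b f.
Proof. by rewrite exprn_ge0 // sumr_ge0 // => y _; rewrite mulr_ge0. Qed.

Lemma W_ge0 T : 0 <= W T.
Proof. exact: sumr_ge0. Qed.

Lemma allowed_upd b x f y y' : ~~ e b x -> allowed b (upd f x y') y = allowed b f y.
Proof.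
move=> bx; apply: eq_forallb => z; case bz: (e b z) => //=.
by rewrite upd_neq //; apply: contraNneq bx => <-.
Qed.

Lemma indicator_prod (l : seq V) (P : pred V) :
  \prod_(x <- l) (P x)%:R = (all P l)%:R :> R.
Proof.
elim: l => [|x l IH]; first by rewrite big_nil.
by rewrite big_cons IH /= -natrM mulnb.
Qed.

(** Only the term where [T] is the exact set of colours used around [b] is
    needed; relaxing to all [T] that contain these colours turns the bound into a
    sum of products over the neighbours, which [isum_prod] evaluates. *)
Lemma star_weight_le (b : V) f (l : seq V) :
  (forall x, (x \in l) = e b x) ->
  star_weight b f <= \sum_(T : {set 'I_q}) W (~: T) ^+ d * \prod_(x <- l) (f x \in T)%:R.
Proof.
move=> lP; set T0 := [set f x | x in [set x | e b x]].
rewrite (bigD1 T0) //= indicator_prod (_ : all _ _); last first.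
  by apply/allP => x; rewrite lP => bx; apply: imset_f; rewrite inE.
rewrite mulr1 (_ : star_weight b f = W (~: T0) ^+ d).
  rewrite lerDl sumr_ge0 // => T _; rewrite mulr_ge0 ?exprn_ge0 ?W_ge0 //.
  by rewrite indicator_prod.
congr (_ ^+ _); rewrite /W [RHS]big_mkcond; apply: eq_bigr => y _.
have -> : (y \in ~: T0) = allowed b f y.
  rewrite inE; apply/idP/forallP => [yT x|H].
    apply/implyP => bx; apply: contraNneq yT => <-.
    by apply: imset_f; rewrite inE.
  apply/imsetP => -[x]; rewrite inE => bx yE.
  by have := H x; rewrite bx yE eqxx.
by case: allowed; rewrite ?mulr1 ?mulr0.
Qed.

(** This is the partition function of the complete bipartite graph with sides of
    size [d], bounded by its [2 ^ q] ways of sharing the colours between the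
    sides; [expR q] majorises [2 ^ q]. *)
Lemma isum_star_weight_le b f (l : seq V) : uniq l -> (forall x, (x \in l) = e b x) ->
  isum w l (star_weight b) f <= (K * expR (q%:R / d%:R)) ^+ d.
Proof.
move=> ul lP; have sl : size l = d.
  rewrite -(e_reg b) -(card_uniqP ul); apply: eq_card => x.
  by rewrite inE lP.
apply: (le_trans (isum_le w_ge0 _ _ (fun g => star_weight_le g lP))).
rewrite (isum_sum w
  (fun (T : {set 'I_q}) (g : {ffun V -> 'I_q}) =>
     W (~: T) ^+ d * \prod_(x <- l) (g x \in T)%:R)).
apply: (@le_trans _ _ (\sum_(T : {set 'I_q}) K ^+ d)).
  apply: ler_sum => T _; rewrite (isum_scale w (c := fun=> W (~: T) ^+ d)) //.
  rewrite (isum_prod w (phi := fun (_ : V) (_ : {ffun V -> 'I_q}) y => (y \in T)%:R)) //.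
  rewrite big_const_seq.
  rewrite count_predT sl.
  have -> : \sum_y w y * (y \in T)%:R = W T.
    rewrite /W [RHS]big_mkcond; apply: eq_bigr => y _.
    by case: (y \in T); rewrite ?mulr1 ?mulr0.
  rewrite -Monoid.iteropE /= -[iterop _ _ _ _]/(W T ^+ d).
  rewrite -exprMn mulrC; apply: lerXn2r; rewrite ?nnegrE ?mulr_ge0 ?W_ge0 //.
rewrite sumr_const exprMn -[leLHS]mulr_natr ler_wpM2l ?exprn_ge0 //.
rewrite -expRM_natr divfK ?pnatr_eq0 -?lt0n //.
have -> : #|{: {set 'I_q}}| = (2 ^ q)%N.
  by rewrite -cardsT -powersetT card_powerset cardsT card_ord.
rewrite natrX -[q%:R]mul1r expRM_natr.
apply: lerXn2r; rewrite ?nnegrE ?expR_ge0 //.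
by have := expR_ge1Dx (1 : R).
Qed.

Lemma proper_le_prod_allowed (f : {ffun V -> 'I_q}) :
  (f \in proper_colourings e q)%:R <=
  \prod_(b <- enum (~: A)) (allowed b f (f b))%:R :> R.
Proof.
rewrite indicator_prod ler_nat; case: (boolP (f \in _)) => // fP.
rewrite (_ : all _ _) //; apply/allP => b _; apply/forallP => x.
apply/implyP => bx; move: fP; rewrite inE => /forallP/(_ b)/forallP/(_ x).
by rewrite bx eq_sym.
Qed.

(** The inequality of Galvin and Tetali for colourings, with the value for the
    complete bipartite graph replaced by its upper bound above. *)
Lemma partition_le :
  \sum_(chi in proper_colourings e q) \prod_v w (chi v) <=
  (K * expR (q%:R / d%:R)) ^+ #|~: A|.
Proof.
have X0 : 0 <= K * expR (q%:R / d%:R) by rewrite mulr_ge0 ?expR_ge0.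
case: (pickP (mem (proper_colourings e q))) => [f0 _|none]; last first.
  by rewrite big_pred0 ?exprn_ge0.
(* Side [~: A] must be innermost: it is summed first. *)
set F := fun f : {ffun V -> 'I_q} => (f \in proper_colourings e q)%:R : R.
have uAB : uniq (enum A ++ enum (~: A)).
  rewrite cat_uniq !enum_uniq andbT /=; apply/hasPn => x.
  by rewrite !mem_enum inE.
have allAB x : x \in enum A ++ enum (~: A).
  by rewrite mem_cat !mem_enum inE orbN.
have -> : \sum_(chi in proper_colourings e q) \prod_v w (chi v) =
    isum w (enum A ++ enum (~: A)) F f0.
  rewrite isum_full // big_mkcond [RHS]big_mkcond; apply: eq_bigr => g _.
  have -> : [forall x, (x \notin enum A ++ enum (~: A)) ==> (g x == f0 x)].
    by apply/forallP => x; rewrite allAB.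
  have -> : \prod_(x <- enum A ++ enum (~: A)) w (g x) = \prod_v w (g v).
    rewrite -[RHS]big_enum; apply: perm_big; apply: uniq_perm => //.
      exact: enum_uniq.
    by move=> x; rewrite allAB mem_enum.
  by rewrite /F; case: ifP; rewrite ?mulr1 ?mulr0.
rewrite isum_cat.
have inner g : isum w (enum (~: A)) F g <= \prod_(b in ~: A) droot d (star_weight b g).
  apply: (le_trans (isum_le w_ge0 _ _ proper_le_prod_allowed)).
  rewrite (isum_prod w (phi := fun b f y => (allowed b f y)%:R)) ?enum_uniq //.
    rewrite big_enum; apply: ler_prod => b _; rewrite drootX ?lexx ?andbT //.
      by rewrite sumr_ge0 // => y _; rewrite mulr_ge0.
    by rewrite sumr_ge0 // => y _; rewrite mulr_ge0.
  move=> b z; rewrite !mem_enum !inE => bA zA y h y'.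
  rewrite allowed_upd //; apply: contraNN zA => bz; exact: side_in bz bA.
apply: (le_trans (isum_le w_ge0 _ _ inner)).
apply: (le_trans (finner w_ge0 (B := ~: A) (N := fun b => [set x | e b x])
  _ d_gt0 _ star_weight_ge0 _)).
- move=> x; rewrite mem_enum => xA; rewrite -(e_reg x); apply: eq_card => b.
  rewrite !inE e_sym; case exb: (e x b); rewrite ?andbF // (side_notin exb) //.
- move=> b x; rewrite inE => bx g y; rewrite /star_weight; congr (_ ^+ _).
  by apply: eq_bigr => y' _; rewrite allowed_upd.
rewrite -prodr_const; apply: ler_prod => b; rewrite inE => bA.
rewrite droot_ge0 /=; apply: droot_le => //.
  by apply: isum_ge0 => // g; exact: star_weight_ge0.
apply: isum_star_weight_le; first by rewrite filter_uniq ?enum_uniq.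
move=> x; rewrite mem_filter mem_enum inE.
by case bx: (e b x) => //=; rewrite (side_in bx).
Qed.

End Partition.

(** * Lower bound on the number of colourings *)

Section Counting.

Variables (q d : nat) (V : finType) (e : rel V) (A : {set V}).
Hypotheses (d_gt0 : (0 < d)%N) (e_sym : symmetric e).
Hypothesis e_bip : forall u v, e u v -> (u \in A) != (v \in A).
Hypothesis e_reg : regular_graph e d.

Lemma count_ge (T : {set 'I_q}) :
  ((#|T| * #|~: T|) ^ #|~: A| <= #|proper_colourings e q|)%N.
Proof.
pose F v : {set 'I_q} := if v \in A then T else ~: T.
have <- : #|family F| = ((#|T| * #|~: T|) ^ #|~: A|)%N.
  rewrite card_family foldrE big_map big_enum /= (bigID (mem A)) /= expnMn.
  congr (_ * _)%N.
    rewrite -(card_sides d_gt0 e_sym e_bip e_reg) -prod_nat_const.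
    by apply: eq_bigr => v vA; rewrite /F vA.
  rewrite -prod_nat_const; apply: eq_big => v; first by rewrite inE.
  by rewrite /F => /negbTE->.
apply: subset_leq_card; apply/subsetP => f /familyP fF; rewrite inE.
apply/forallP => u; apply/forallP => v; apply/implyP => euv.
have := fF u; have := fF v; rewrite /F; have := e_bip euv.
case: (u \in A) (v \in A) => [] [] //= _; rewrite !inE => fv fu;
  by [apply: contraNneq fv => <-|apply: contraNneq fu => ->].
Qed.

Lemma exists_colour_set (m : nat) : (m <= q)%N ->
  exists T : {set 'I_q}, #|T| = m /\ #|~: T| = (q - m)%N.
Proof.
move=> mq; exists [set widen_ord mq i | i : 'I_m].
have cT : #|[set widen_ord mq i | i : 'I_m]| = m.
  rewrite card_imset ?card_ord // => i j /(congr1 val) ij; exact: val_inj.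
by split=> //; rewrite cardsCs setCK cT card_ord.
Qed.

Lemma count_ge_split (m : nat) : (m <= q)%N ->
  ((m * (q - m)) ^ #|~: A| <= #|proper_colourings e q|)%N.
Proof. by move=> /exists_colour_set[T [<- <-]]; exact: count_ge. Qed.

End Counting.

(** * Exponential tilting and the tail bound *)

Section Tail.

Variables (R : realType) (q d : nat) (V : finType) (e : rel V) (A : {set V}).
Hypotheses (d_gt0 : (0 < d)%N) (e_sym : symmetric e).
Hypothesis e_bip : forall u v, e u v -> (u \in A) != (v \in A).
Hypothesis e_reg : regular_graph e d.

Definition tilt (k : 'I_q) (l : R) (y : 'I_q) : R := if y == k then l else 1.

Lemma tilt_ge0 k l y : 0 <= l -> 0 <= tilt k l y.
Proof. by rewrite /tilt; case: ifP. Qed.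

Lemma prod_tilt k (t : R) (chi : {ffun V -> 'I_q}) :
  \prod_v tilt k (expR t) (chi v) = expR (t * #|chi @^-1: [set k]|%:R).
Proof.
rewrite expRM_natr -prodr_const [RHS]big_mkcond /=; apply: eq_bigr => v _.
by rewrite /tilt !inE.
Qed.

Lemma mul_sum_tilt k l (T : {set 'I_q}) : k \in T ->
  (\sum_(y in T) tilt k l y) * (\sum_(y in ~: T) tilt k l y) =
  (#|T|.-1%:R + l) * (q.-1%:R - #|T|.-1%:R).
Proof.
move=> kT; have T_gt0 : (0 < #|T|)%N by rewrite card_gt0; apply/set0Pn; exists k.
have Tq : (#|T| <= q)%N by have := max_card (mem T); rewrite card_ord.
congr (_ * _).
  rewrite (bigD1 k) //= /tilt eqxx addrC; congr (_ + _).
  rewrite (eq_bigr (fun=> 1)) => [|y /andP[_ /negbTE->] //].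
  rewrite sumr_const (cardsD1 k T) kT /=; congr (_%:R).
  by apply: eq_card => y; rewrite !inE andbC.
rewrite (eq_bigr (fun=> 1)) => [|y]; last first.
  by rewrite inE /tilt; case: eqP => // ->; rewrite kT.
rewrite sumr_const cardsCs setCK card_ord -natrB; last by lia.
by congr (_%:R); lia.
Qed.

Lemma mul_sum_tilt_le k l K (T : {set 'I_q}) :
  (forall s : nat, (s <= q.-1)%N -> (s%:R + l) * (q.-1%:R - s%:R) <= K) ->
  (\sum_(y in T) tilt k l y) * (\sum_(y in ~: T) tilt k l y) <= K.
Proof.
move=> sK; wlog kT : T / k \in T => [H|].
  have [|kT] := boolP (k \in T); first exact: H.
  by rewrite mulrC -{2}[T]setCK; apply: H; rewrite inE.
rewrite mul_sum_tilt //; apply: sK.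
have Tq : (#|T| <= q)%N by have := max_card (mem T); rewrite card_ord.
by lia.
Qed.

(** [s] is the number of colours other than [k] on the side of the splitting that
    has [k].  The right-hand side is the contribution of one pair of vertices,
    one per side, to [L ^ M] times the moment generating function of a Poisson
    variable of mean [N * P], at [sg * t]. *)
Definition tilt_bound (L P sg : R) : Prop :=
  forall (t : R) (s : nat), 0 <= t <= 4^-1 -> (s <= q.-1)%N ->
  (s%:R + expR (sg * t)) * (q.-1%:R - s%:R) <=
    L * expR (2 * P * (expR (sg * t) - 1)).

(** From [expR (- t) >= 1 - t]; the constant 2 leaves room for [1/(1 - t)]. *)
Lemma expR_sub1_le (t : R) : t <= 4^-1 -> expR t - 1 <= t + 2 * t ^+ 2.
Proof.
move=> t4.
have h : expR t * (1 - t) <= 1.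
  have := expR_ge1Dx (- t); rewrite expRN => H.
  by rewrite mulrC -ler_pdivlMr ?expR_gt0 // mul1r.
have : 1 <= (1 + t + 2 * t ^+ 2) * (1 - t) by nra.
move=> /(le_trans h); rewrite ler_pM2r; last by lra.
by lra.
Qed.

Lemma card_doubled : #|V| = (2 * #|~: A|)%N.
Proof.
by rewrite -(cardsC A) (card_sides d_gt0 e_sym e_bip e_reg) mul2n addnn.
Qed.

(** Markov's inequality for [expR (t * X)], where [X] counts the vertices
    coloured [k] and [t = sg * eps / 4].  Twice [t ^ 2] costs [eps ^ 2 / 8] of the
    gain [eps ^ 2 / 4], and [q / (2 d)] costs at most [eps ^ 2 / 32]. *)
Lemma tail_le (L P sg eps : R) (k : 'I_q) :
  0 < L -> 0 <= P <= 1 -> sg ^+ 2 = 1 -> tilt_bound L P sg ->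
  L ^+ #|~: A| <= #|proper_colourings e q|%:R ->
  0 < eps <= 1 -> q%:R / d%:R <= eps ^+ 2 / 16 ->
  Pr_colouring R e (fun chi => sg * (colour_freq R chi k - P) >= eps) <=
    expR (- (16^-1 * eps ^+ 2 * #|V|%:R)).
Proof.
move=> L0 /andP[P0 P1] sg2 tb Lc /andP[eps0 eps1] qd.
have c_gt0 : 0 < #|proper_colourings e q|%:R :> R.
  by apply: lt_le_trans Lc; rewrite exprn_gt0.
rewrite /Pr_colouring ler_pdivrMr //.
set N : R := #|V|%:R; set M := #|~: A|.
have NM : N = 2 * M%:R by rewrite /N card_doubled natrM.
have N0 : 0 <= N by rewrite /N.
pose t := sg * (eps / 4).
have t2 : t ^+ 2 = eps ^+ 2 / 16 by rewrite exprMn sg2; field.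
have freqN (chi : {ffun V -> 'I_q}) :
    colour_freq R chi k * N = #|chi @^-1: [set k]|%:R.
  rewrite /colour_freq -/N; have [N00|Nn0] := eqVneq N 0; last by rewrite divfK.
  rewrite N00 mulr0; have : (#|chi @^-1: [set k]| <= #|V|)%N by exact: max_card.
  by rewrite -(ler_nat R) -/N N00 => X; apply/eqP; rewrite eq_le X ler0n.
(* Each colouring in the event has a summand at least 1. *)
apply: (@le_trans _ _ (\sum_(chi in proper_colourings e q)
    expR (- t * N * P - eps ^+ 2 / 4 * N) * \prod_v tilt k (expR t) (chi v))).
  rewrite -sum1_card natr_sum big_mkcond [leRHS]big_mkcond /=.
  apply: ler_sum => chi _; rewrite inE.
  have [|//] := boolP (chi \in proper_colourings e q); rewrite /= => _.
  case: ifP => [H|_]; last first.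
    by rewrite mulr_ge0 ?expR_ge0 // prodr_ge0 // => v _; rewrite tilt_ge0 ?expR_ge0.
  rewrite prod_tilt -expRD -freqN; set x := colour_freq _ _ _ in H *.
  rewrite -[1%:R]expR0 ler_expR.
  have -> : - t * N * P - eps ^+ 2 / 4 * N + t * (x * N) =
    eps * N / 4 * (sg * (x - P) - eps) by rewrite /t; field.
  by rewrite mulr_ge0 ?subr_ge0 // !mulr_ge0 // ?invr_ge0 // ltW.
rewrite -mulr_sumr.
have t4 : t <= 4^-1.
  have : sg <= 1 by nra.
  by rewrite /t; nra.
have tilt0 y : 0 <= tilt k (expR t) y by rewrite tilt_ge0 // expR_ge0.
have K0 : 0 <= L * expR (2 * P * (expR t - 1)).
  by rewrite mulr_ge0 ?expR_ge0 // ltW.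
have Kle (T : {set 'I_q}) : (\sum_(y in T) tilt k (expR t) y) *
    (\sum_(y in ~: T) tilt k (expR t) y) <= L * expR (2 * P * (expR t - 1)).
  apply: mul_sum_tilt_le => s sq; apply: tb => //.
  by apply/andP; split; lra.
have := partition_le d_gt0 e_sym e_bip e_reg tilt0 K0 Kle.
move=> /(ler_wpM2l (expR_ge0 _)) H; apply: (le_trans (H _)) => {H}.
rewrite -/M; set a := - t * N * P - _; set B := 2 * P * _.
have -> : expR a * (L * expR B * expR (q%:R / d%:R)) ^+ M =
    L ^+ M * expR (a + (B + q%:R / d%:R) * M%:R).
  by rewrite !exprMn -!expRM_natr mulrDl !expRD; ring.
rewrite [leRHS]mulrC.
apply: ler_pM; rewrite ?expR_ge0 ?exprn_ge0 ?(ltW L0) //.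
rewrite ler_expR /a /B.
have := expR_sub1_le t4; rewrite t2 => et.
have : P * (expR t - 1) <= P * t + eps ^+ 2 / 8.
  have : P * (expR t - 1) <= P * (t + 2 * (eps ^+ 2 / 16)) by rewrite ler_wpM2l.
  have : 0 <= eps ^+ 2 by rewrite exprn_ge0 // ltW.
  by nra.
move=> /(ler_wpM2r N0); have := ler_wpM2r N0 qd; rewrite NM; set r := q%:R / _.
have : 0 <= eps ^+ 2 * M%:R by rewrite mulr_ge0 ?exprn_ge0 // ltW.
set m := M%:R; set E := expR t; move=> a1 a2 a3; nra.
Qed.

Lemma Pr_le_sum (I : finType) (E : pred {ffun V -> 'I_q})
    (E' : I -> pred {ffun V -> 'I_q}) :
  (forall chi, E chi -> exists i, E' i chi) ->
  Pr_colouring R e E <= \sum_i Pr_colouring R e (E' i).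
Proof.
move=> EE; rewrite /Pr_colouring -mulr_suml; apply: ler_wpM2r.
  by rewrite invr_ge0.
rewrite -natr_sum ler_nat.
under [leqRHS]eq_bigr do rewrite -sum1_card big_mkcond.
rewrite exchange_big -sum1_card big_mkcond /=.
apply: leq_sum => chi _; rewrite inE; case: ifP => // /andP[cP /EE[i Ei]].
by rewrite (bigD1 i) //= inE cP Ei.
Qed.

(** The union bound over a family of one-sided deviations, each given by a colour
    [kk i] and a direction [sg i]; the slack between [2 q] and [2 q + 1] makes
    the inequality strict. *)
Lemma deviation_lt (I : finType) (kk : I -> 'I_q) (sg : I -> R) (L P eps : R)
    (E : pred {ffun V -> 'I_q}) :
  (0 < q)%N -> (#|I| <= 2 * q)%N ->
  0 < L -> 0 <= P <= 1 -> (forall i, sg i ^+ 2 = 1) ->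
  (forall i, tilt_bound L P (sg i)) ->
  L ^+ #|~: A| <= #|proper_colourings e q|%:R ->
  4 * q%:R / Num.sqrt d%:R <= eps ->
  (forall chi, E chi ->
     exists i, sg i * (colour_freq R chi (kk i) - P) >= eps) ->
  Pr_colouring R e E <
    (2 * q%:R + 1) * eps^-1 * 2 `^ (- (16^-1 * eps ^+ 2 * #|V|%:R)).
Proof.
move=> q0 cI L0 P01 sg2 tb Lc deps EE.
have qR : 1 <= q%:R :> R by rewrite ler1n.
have d0 : 0 < d%:R :> R by rewrite ltr0n.
have sd0 : 0 < Num.sqrt d%:R :> R by rewrite sqrtr_gt0.
have eps0 : 0 < eps by apply: lt_le_trans deps; rewrite divr_gt0 //; lra.
have rhs0 : 0 < 2 `^ (- (16^-1 * eps ^+ 2 * #|V|%:R)) :> R by rewrite powR_gt0.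
have freq01 (chi : {ffun V -> 'I_q}) k : 0 <= colour_freq R chi k <= 1.
  rewrite /colour_freq divr_ge0 //=; have [->|Vn0] := eqVneq #|V|%:R (0 : R).
    by rewrite invr0 mulr0.
  by rewrite ler_pdivrMr ?mul1r ?ler_nat ?max_card // lt_neqAle eq_sym Vn0 /=.
(* Frequencies and [P] lie in [0, 1], so deviations above 1 are impossible. *)
have [eps1|eps1] := leP eps 1; last first.
  rewrite (_ : Pr_colouring R e E = 0); last first.
    rewrite /Pr_colouring (_ : [set _ in _ | _] = set0) ?cards0 ?mul0r //.
    apply/setP => chi; rewrite !inE; apply/negbTE; apply/negP => /andP[_ /EE[i]].
    have := freq01 chi (kk i); set x := colour_freq _ _ _.
    have /eqP := sg2 i; rewrite sqrf_eq1 => /orP[]/eqP->; lra.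
  by rewrite !mulr_gt0 ?invr_gt0 //; lra.
have qd : q%:R / d%:R <= eps ^+ 2 / 16.
  have : (4 * q%:R) ^+ 2 / d%:R <= eps ^+ 2.
    have -> : (4 * q%:R) ^+ 2 / d%:R = (4 * q%:R / Num.sqrt d%:R) ^+ 2 :> R.
      by rewrite expr_div_n sqr_sqrtr // ltW.
    by rewrite ler_pXn2r ?nnegrE ?(ltW eps0) // divr_ge0 ?ltW //; lra.
  have : 16 * (q%:R / d%:R) <= (4 * q%:R) ^+ 2 / d%:R :> R.
    by rewrite mulrA ler_pM2r ?invr_gt0 //; nra.
  by lra.
apply: (le_lt_trans (Pr_le_sum EE)).
apply: (@le_lt_trans _ _
    ((2 * q%:R) * expR (- (16^-1 * eps ^+ 2 * #|V|%:R)))).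
  apply: (@le_trans _ _ (\sum_(i : I) expR (- (16^-1 * eps ^+ 2 * #|V|%:R)))).
    apply: ler_sum => i _; apply: tail_le L0 P01 (sg2 i) (tb i) Lc _ qd.
    by rewrite eps0.
  rewrite sumr_const -[leLHS]mulr_natl ler_wpM2r ?expR_ge0 //.
  by rewrite -natrM ler_nat.
set x := 16^-1 * _ * _ in rhs0 *.
have x0 : 0 <= x by rewrite /x !mulr_ge0 ?invr_ge0 ?exprn_ge0 ?(ltW eps0).
have e2 : expR (- x) <= 2 `^ (- x).
  rewrite /powR pnatr_eq0 /= ler_expR mulNr lerN2 ler_piMr //.
  by have := @le_ln1Dx R 1; rewrite (_ : 1 + 1 = 2) //; apply; lra.
have ie : 1 <= eps^-1 by rewrite invf_ge1.
apply: (@le_lt_trans _ _ ((2 * q%:R) * 2 `^ (- x))).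
  by rewrite ler_wpM2l //; lra.
rewrite ltr_pM2r //; nra.
Qed.

End Tail.

(** * The optimal splittings of the colour set *)

Section TiltBounds.

Variables (R : realType) (m : nat).
Hypothesis m_gt0 : (0 < m)%N.

(** The two factors have sum [q - 1 + l], so their product is at most the square
    of half this sum. *)
Lemma tilt_bound_even (sg : R) :
  tilt_bound (2 * m) (m * (2 * m - m))%:R (1 / (2 * m)%:R) sg.
Proof.
move=> t s _ _; set l := expR _.
have mR : 1 <= m%:R :> R by rewrite ler1n.
rewrite (_ : (2 * m - m = m)%N); last by lia.
rewrite !natrM; set M := m%:R in mR *.
have -> : (2 * m).-1%:R = 2 * M - 1 :> R.
  by rewrite -subn1 natrB ?natrM //; lia.
have -> : 2 * (1 / (2 * M)) * (l - 1) = (l - 1) / (2 * M) * 2.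
  by field; lra.
rewrite expRM_natr.
apply: (@le_trans _ _ (M * M * (1 + (l - 1) / (2 * M)) ^+ 2)).
  have -> : M * M * (1 + (l - 1) / (2 * M)) ^+ 2 = ((2 * M - 1 + l) / 2) ^+ 2.
    by field; lra.
  have := sqr_ge0 (s%:R + l - (2 * M - 1 - s%:R)); nra.
apply: ler_wpM2l; first by nra.
have l0 : 0 < l by exact: expR_gt0.
apply: lerXn2r; rewrite ?nnegrE ?expR_ge0 ?expR_ge1Dx //.
have -> : 1 + (l - 1) / (2 * M) = (2 * M - 1 + l) / (2 * M) by field; lra.
by rewrite divr_ge0; lra.
Qed.

Lemma natr_cases (a b : nat) :
  [\/ a%:R + 1 <= b%:R :> R, a%:R = b%:R :> R | b%:R + 1 <= a%:R :> R].
Proof.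
rewrite !natr1 !ler_nat; case: (ltngtP a b) => [ab|ab|->];
  by [constructor 1|constructor 3|constructor 2].
Qed.

(** For [l <= 1] the product is largest when [s = m]: with [j = m - s] the
    deficit is [j * (j - l)], nonnegative at all integers [j]. *)
Lemma tilt_bound_odd_lower :
  tilt_bound (2 * m).+1 (m * ((2 * m).+1 - m))%:R
    (1 / ((2 * m).+1%:R + 1)) (-1 : R).
Proof.
move=> t s /andP[t0 _] _; rewrite mulN1r /=; set l := expR _.
have mR : 1 <= m%:R :> R by rewrite ler1n.
have l1 : l <= 1 by rewrite expR_le1; lra.
have l0 : 0 < l by exact: expR_gt0.
rewrite (_ : ((2 * m).+1 - m = m.+1)%N); last by lia.
have q1 : (2 * m).+1%:R = 2 * m%:R + 1 :> R by rewrite -natr1 natrM.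
have m1 : m.+1%:R = m%:R + 1 :> R by rewrite natr1.
rewrite !natrM q1 m1; set M := m%:R in mR *.
have -> : 2 * (1 / (2 * M + 1 + 1)) * (l - 1) = (l - 1) / (M + 1).
  by field; lra.
apply: (@le_trans _ _ (M * (M + 1) * (1 + (l - 1) / (M + 1)))); last first.
  by apply: ler_wpM2l; [nra|exact: expR_ge1Dx].
have -> : M * (M + 1) * (1 + (l - 1) / (M + 1)) = M * (M + l).
  by field; lra.
have : 0 <= (M - s%:R) * (M - s%:R - l).
  by have [] := natr_cases s m; rewrite -/M => H; nra.
by nra.
Qed.

(** For [1 <= l <= 2] the product is largest when [s = m - 1]: with [j = m - s]
    the deficit is [(j - 1) * (j + 1 - l)], nonnegative at all integers [j]. *)
Lemma tilt_bound_odd_upper :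
  tilt_bound (2 * m).+1 (m * ((2 * m).+1 - m))%:R
    (1 / ((2 * m).+1%:R - 1)) (1 : R).
Proof.
move=> t s /andP[t0 t4] _; rewrite mul1r /=; set l := expR _.
have mR : 1 <= m%:R :> R by rewrite ler1n.
have l1 : 1 <= l by rewrite -expR0 ler_expR.
have l2 : l <= 2.
  by have := expR_sub1_le t4; rewrite -/l; nra.
rewrite (_ : ((2 * m).+1 - m = m.+1)%N); last by lia.
have q1 : (2 * m).+1%:R = 2 * m%:R + 1 :> R by rewrite -natr1 natrM.
have m1 : m.+1%:R = m%:R + 1 :> R by rewrite natr1.
rewrite !natrM q1 m1; set M := m%:R in mR *.
have -> : 2 * (1 / (2 * M + 1 - 1)) * (l - 1) = (l - 1) / M.
  by field; lra.
apply: (@le_trans _ _ (M * (M + 1) * (1 + (l - 1) / M))); last first.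
  by apply: ler_wpM2l; [nra|exact: expR_ge1Dx].
have -> : M * (M + 1) * (1 + (l - 1) / M) = (M + 1) * (M - 1 + l).
  by field; lra.
have : 0 <= (M - s%:R - 1) * (M - s%:R + 1 - l).
  by have [] := natr_cases s m; rewrite -/M => H; nra.
by nra.
Qed.

End TiltBounds.

(** * Deviations of the colour frequencies *)

Theorem corollary1p5 (R : realType) (q : nat) (hq : (2 <= q)%N) :
  exists c1 c2 c3 : R, [/\ 0 < c1, 0 < c2, 0 < c3 &
    forall (d N : nat) (V : finType) (e : rel V) (eps : R),
      (1 <= d)%N -> #|V| = N ->
      simple_graph e -> bipartite_graph e -> regular_graph e d ->
      c1 / Num.sqrt d%:R <= eps ->
      (~~ odd q ->
         Pr_colouring R e (fun chi : {ffun V -> 'I_q} =>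
             [exists k : 'I_q, `|colour_freq R chi k - 1 / q%:R| >= eps])
           <= c2 * eps^-1 * 2 `^ (- (c3 * eps ^+ 2 * N%:R)))
      /\
      (odd q ->
         Pr_colouring R e (fun chi : {ffun V -> 'I_q} =>
             [exists k : 'I_q, colour_freq R chi k <= 1 / (q%:R + 1) - eps])
           < c2 * eps^-1 * 2 `^ (- (c3 * eps ^+ 2 * N%:R))
         /\
         Pr_colouring R e (fun chi : {ffun V -> 'I_q} =>
             [exists k : 'I_q, colour_freq R chi k >= 1 / (q%:R - 1) + eps])
           < c2 * eps^-1 * 2 `^ (- (c3 * eps ^+ 2 * N%:R)))].
Proof.
have qR : 2 <= q%:R :> R by rewrite (ler_nat R 2 q).
have q_gt0 : (0 < q)%N by lia.
exists (4 * q%:R), (2 * q%:R + 1), 16^-1; split; [lra|lra|lra|].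
move=> d N V e eps d_gt0 <- [e_sym _] [A e_bip] e_reg deps.
have count m : (m <= q)%N ->
    ((m * (q - m))%:R : R) ^+ #|~: A| <= #|proper_colourings e q|%:R.
  by move=> mq; rewrite -natrX ler_nat; apply: count_ge_split e_reg _ _.
have dev := @deviation_lt R q d V e A d_gt0 e_sym e_bip e_reg.
pose m := q./2; have m_gt0 : (0 < m)%N by rewrite /m; lia.
split=> [q_even|q_odd].
  have q2 : q = (2 * m)%N by rewrite /m; lia.
  apply/ltW; apply: (dev ('I_q * bool)%type fst
    (fun i => (-1) ^+ i.2) (m * (q - m))%:R (1 / q%:R)) => //.
  - by rewrite card_prod card_ord card_bool mulnC.
  - by rewrite ltr0n; lia.
  - by rewrite div1r invr_ge0 invf_le1; lra.
  - by move=> i; rewrite sqrr_sign.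
  - by move=> i; have := tilt_bound_even m_gt0 ((-1) ^+ i.2 : R); rewrite -q2.
  - by apply: count; lia.
  move=> chi /existsP[k]; rewrite ler_normr => /orP[H|H].
    by exists (k, false); rewrite expr0 [leRHS]mul1r.
  by exists (k, true); rewrite expr1 [leRHS]mulN1r.
have q2 : q = (2 * m).+1 by rewrite /m; lia.
split.
  apply: (dev 'I_q id (fun=> -1) (m * (q - m))%:R (1 / (q%:R + 1))) => //.
  - by rewrite card_ord; lia.
  - by rewrite ltr0n; lia.
  - by rewrite div1r invr_ge0 invf_le1; lra.
  - by move=> _; rewrite sqrrN expr1n.
  - by move=> _; have := @tilt_bound_odd_lower R _ m_gt0; rewrite -q2.
  - by apply: count; lia.
  by move=> chi /existsP[k H]; exists k => /=; lra.
apply: (dev 'I_q id (fun=> 1) (m * (q - m))%:R (1 / (q%:R - 1))) => //.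
- by rewrite card_ord; lia.
- by rewrite ltr0n; lia.
- by rewrite div1r invr_ge0 invf_le1; lra.
- by move=> _; rewrite expr1n.
- by move=> _; have := @tilt_bound_odd_upper R _ m_gt0; rewrite -q2.
- by apply: count; lia.
by move=> chi /existsP[k H]; exists k => /=; lra.
Qed.
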